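(* Let $K$ be a field of characteristic $0$ with henselian valuation ring $A$, maximal ideal $\mathfrak{m}_A$, valuation $v$ and residue field of characteristic $p>0$, containing a primitive $p$-th root of unity $\zeta$; put $\mathfrak{z}=\zeta-1$. Let $L|K$ be a Kummer extension of degree $p$ with defect $p$, $B$ the integral closure of $A$ in $L$. Let $\mathfrak{A}'=\{h\in\mathfrak{A}: h\in A^\times,\ h-1\in\mathfrak{m}_A\}$ and $\mathscr{S}=\{\alpha\in L:\alpha^p\in\mathfrak{A}'\}$. For each $\alpha\in\mathscr{S}$ there is $\alpha'\in B^\times\cap(\alpha-1)K^\times$, namely $\alpha'=\gamma_\alpha(\alpha-1)/\mathfrak{z}$ with $\gamma_\alpha\in A$ chosen so that $\alpha'\in B^\times$, such that $B=\bigcup_{\alpha\in\mathscr{S}}A[\alpha']$ is a filtered union, i.e.: (i) for any $\alpha_1,\alpha_2\in\mathscr{S}$, either $A[\alpha_1']\subset A[\alpha_2']$ or $A[\alpha_2']\subset A[\alpha_1']$; (ii) for every $\beta\in B$ there exists $\alpha\in\mathscr{S}$ with $\beta\in A[\alpha']$.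
   Context: $\mathfrak{A}$ is the set of $h\in K$ such that the solutions of $X^p=h$ generate $L$ over $K$. With $w$ the extension of $v$ to $L$, $k,l$ the residue fields, $e=(w(L^\times):v(K^\times))$, $f=[l:k]$, the defect $d$ is given by $p=def$; here $d=p$ (so $e=f=1$). The ring $A[\alpha']$ does not depend on the choice of $\gamma_\alpha$. *)

(* Defs.v *)
From HB Require Import structures.
From mathcomp Require Import all_boot all_order all_algebra all_field.
Set Implicit Arguments. Unset Strict Implicit. Unset Printing Implicit Defensive.
Import GRing.Theory.
Local Open Scope ring_scope.

Definition valuation_ring (K : fieldType) (A : {pred K}) : Prop :=
  [/\ 1 \in A,
      (forall x y, x \in A -> y \in A -> x - y \in A),
      (forall x y, x \in A -> y \in A -> x * y \in A) &
      (forall x, x != 0 -> x \in A \/ x^-1 \in A)].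

Definition unit_in (F : fieldType) (P : F -> Prop) (x : F) : Prop :=
  [/\ x != 0, P x & P x^-1].
Definition maxideal_in (F : fieldType) (P : F -> Prop) (x : F) : Prop :=
  P x /\ ~ unit_in P x.

Definition memA (K : fieldType) (A : {pred K}) : K -> Prop := fun x => x \in A.

Definition henselian (K : fieldType) (A : {pred K}) : Prop :=
  forall (f : {poly K}) (a : K),
    f \is monic -> (forall i, f`_i \in A) -> a \in A ->
    maxideal_in (memA A) f.[a] -> unit_in (memA A) (f^`()).[a] ->
    exists b : K, [/\ b \in A, root f b & maxideal_in (memA A) (b - a)].

Definition integral_closure (K : fieldType) (L : fieldExtType K) (A : {pred K})
  (x : L) : Prop :=
  exists q : {poly K}, [/\ q \is monic, (forall i, q`_i \in A) &
                            root (map_poly (in_alg L) q) x].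

Definition kummer_gen (K : fieldType) (L : fieldExtType K) (p : nat) (h : K) : Prop :=
  exists theta : L, theta ^+ p = h%:A /\ <<1; theta>>%VS = fullv.

Definition adjoin_ring (K : fieldType) (L : fieldExtType K) (A : {pred K})
  (x : L) : L -> Prop :=
  fun y => exists q : {poly K}, (forall i, q`_i \in A) /\
                               y = (map_poly (in_alg L) q).[x].

(* Main.v *)
(* The pairs (c, d) with v(d) = v(theta - c) describe how K approximates a
   generator theta of L. Since L|K is immediate, v(theta - c) has no maximum.
   Every polynomial f of degree less than p is eventually dominated by its
   constant term on the disc of center c and radius v(d) (Kaplansky): by
   induction on the degree this holds for f', and as the integers below p are
   units, the linear term of f dominates the higher ones; then either the
   constant term dominates it too, or Hensel's lemma gives f a root in K, and f
   is a product of polynomials of lower degree.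
   Hence if beta = f(theta) is integral, f(c + dX) has coefficients in A, i.e.
   beta is in A[(theta - c)/d]. Starting from a 1-unit theta with theta^p in K,
   c is a 1-unit, alpha = theta/c is in S and A[alpha'] = A[(theta - c)/d].
   The rings A[alpha'] form a chain because alpha_1 = d alpha_2^i with d in K
   and 0 < i < p, whence alpha_1 - 1 = d (alpha_2^i - 1) + (d - 1). *)
Require Import Defs.
From HB Require Import structures.
From mathcomp Require Import all_boot all_order all_algebra all_field.
From mathcomp Require Import boolp ring.
Import GRing.Theory.
Local Open Scope ring_scope.

(** * Units and maximal ideal of a valuation ring *)

Section ValuationRing.
Variables (F : fieldType) (V : subringClosed F).

(** Boolean forms of [unit_in] and [maxideal_in], with [V] a bundled subring so that the [rpred]
    lemmas apply. *)
Definition vunit : {pred F} := [pred x | [&& x != 0, x \in V & x^-1 \in V]].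
Definition vmax : {pred F} := [pred x | (x \in V) && (x \notin vunit)].

Hypothesis V_total : forall x, x != 0 -> x \in V \/ x^-1 \in V.

Lemma vunitP x : reflect (unit_in (memA V) x) (x \in vunit).
Proof. exact: and3P. Qed.

Lemma vmaxP x : reflect (maxideal_in (memA V) x) (x \in vmax).
Proof.
apply: (iffP andP) => [] [Vx Ux]; split=> //.
  by move=> /vunitP; apply/negP.
by apply/negP => /vunitP.
Qed.

Lemma vunit_neq0 {x} : x \in vunit -> x != 0. Proof. by case/and3P. Qed.
Lemma vunitW {x} : x \in vunit -> x \in V. Proof. by case/and3P. Qed.
Lemma vmaxW {x} : x \in vmax -> x \in V. Proof. by case/andP. Qed.

Lemma vunit1 : 1 \in vunit.
Proof. by rewrite inE oner_eq0 invr1 rpred1. Qed.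

Lemma vunitV x : (x^-1 \in vunit) = (x \in vunit).
Proof. by rewrite !inE invr_eq0 invrK [(x \in V) && _]andbC. Qed.

Lemma vunitM x y : x \in vunit -> y \in vunit -> x * y \in vunit.
Proof.
case/and3P=> x0 Vx Vx' /and3P[y0 Vy Vy'].
by apply/and3P; rewrite mulf_neq0 // invfM !rpredM.
Qed.

Lemma vunitX x n : x \in vunit -> x ^+ n \in vunit.
Proof. by move=> Ux; elim: n => [|n IH]; rewrite ?vunit1 // exprS vunitM. Qed.

Lemma vunitN x : (- x \in vunit) = (x \in vunit).
Proof. by rewrite !inE oppr_eq0 invrN !rpredN. Qed.

Lemma vmax_or_vunit {x} : x \in V -> (x \in vmax) || (x \in vunit).
Proof. by rewrite [x \in vmax]inE => ->; rewrite orNb. Qed.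

Lemma vunit_not_vmax x : x \in vunit -> x \in vmax -> False.
Proof. by move=> Ux /andP[_ /negP]. Qed.

Lemma vmax0 : 0 \in vmax.
Proof. by rewrite !inE rpred0 eqxx. Qed.

(** If [a * x] were a unit, then [x^-1 = a * (a * x)^-1] would lie in [V]. *)
Lemma vmaxMl a x : a \in V -> x \in vmax -> a * x \in vmax.
Proof.
move=> Va /andP[Vx nUx]; apply/andP; split; first exact: rpredM.
apply/negP => /and3P[]; rewrite mulf_eq0 => /norP[a0 x0] _.
rewrite invfM => Vax; case/negP: nUx; apply/and3P; split=> //.
by rewrite -[x^-1](mulVKf a0) rpredM.
Qed.

Lemma vmaxMr a x : x \in vmax -> a \in V -> x * a \in vmax.
Proof. by rewrite mulrC => mx Va; apply: vmaxMl. Qed.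

Lemma vmaxX x n : x \in vmax -> (0 < n)%N -> x ^+ n \in vmax.
Proof. by case: n => // n mx _; rewrite exprS vmaxMr // rpredX // vmaxW. Qed.

Lemma vmax_radical x n : x \in V -> x ^+ n \in vmax -> x \in vmax.
Proof.
move=> Vx mx; case/orP: (vmax_or_vunit Vx) => // /(vunitX _ n) Ux.
by case: (vunit_not_vmax _ Ux mx).
Qed.

Lemma vmaxV_notin x : x \notin V -> x^-1 \in vmax.
Proof.
have [->|x0 nVx] := eqVneq x 0; first by rewrite rpred0.
case: (V_total x x0) => [Vx|Vx']; first by rewrite Vx in nVx.
by rewrite !inE Vx' invrK (negPf nVx) !andbF.
Qed.

Let vmaxB_wlog x y : x \in vmax -> y \in vmax -> x / y \in V -> x - y \in vmax.
Proof.
have [-> mx _ _|y0] := eqVneq y 0; first by rewrite subr0.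
move=> mx my Vxy; rewrite -[X in X - _](divfK y0) -[X in _ - X]mul1r -mulrBl.
by rewrite vmaxMl // rpredB ?rpred1.
Qed.

(** One of [x / y], [y / x] lies in [V], so the difference is a multiple in [V] of [y] or of [x]. *)
Fact vmax_zmod_closed : zmod_closed vmax.
Proof.
split=> [|x y mx my]; first exact: vmax0.
have [-> |x0] := eqVneq x 0.
  by rewrite sub0r -mulN1r vmaxMl // rpredN rpred1.
have [->|y0] := eqVneq y 0; first by rewrite subr0.
case: (V_total (x / y)); first by rewrite mulf_neq0 ?invr_eq0.
  exact: vmaxB_wlog.
rewrite invfM invrK mulrC => Vyx; rewrite -opprB -mulN1r.
by rewrite vmaxMl ?rpredN ?rpred1 ?vmaxB_wlog.
Qed.

Lemma vmaxB x y : x \in vmax -> y \in vmax -> x - y \in vmax.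
Proof. by have [_] := vmax_zmod_closed; apply. Qed.

Lemma vmaxN x : (- x \in vmax) = (x \in vmax).
Proof. by rewrite [LHS]inE [RHS]inE vunitN rpredN. Qed.

Lemma vmaxD x y : x \in vmax -> y \in vmax -> x + y \in vmax.
Proof. by move=> mx my; rewrite -[y]opprK vmaxB ?vmaxN. Qed.

Lemma vmax_sum (I : Type) (r : seq I) (P : pred I) (E : I -> F) :
  (forall i, P i -> E i \in vmax) -> \sum_(i <- r | P i) E i \in vmax.
Proof.
move=> mE; apply: (big_ind (fun x => x \in vmax)) mE; first exact: vmax0.
exact: vmaxD.
Qed.

Lemma vunitDr u x : u \in vunit -> x \in vmax -> u + x \in vunit.
Proof.
move=> Uu mx; have /vmax_or_vunit/orP[mux|//] : u + x \in V.
  by rewrite rpredD ?(vunitW Uu) ?(vmaxW mx).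
by case: (vunit_not_vmax u Uu); rewrite -(addrK x u) vmaxB.
Qed.

Lemma horner_vmax (q : {poly F}) x :
  (forall i, q`_i \in vmax) -> x \in V -> q.[x] \in vmax.
Proof.
by move=> mq Vx; rewrite horner_coef vmax_sum // => i _; rewrite vmaxMr ?rpredX.
Qed.

Lemma horner_valring (q : {poly F}) x :
  (forall i, q`_i \in V) -> x \in V -> q.[x] \in V.
Proof. by move=> /polyOverP Vq Vx; apply: rpred_horner. Qed.

End ValuationRing.

(** * Hensel's lemma for polynomials that need not be monic *)

Section Hensel.
Variables (K : fieldType) (A : subringClosed K).
Hypothesis A_total : forall x, x != 0 -> x \in A \/ x^-1 \in A.
Hypothesis A_hensel : henselian A.
Local Notation m := (vmax K A).
Local Notation U := (vunit K A).

(* Hensel's lemma is assumed for monic polynomials only: apply it at [-1] to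
   the reciprocal polynomial of [G], which is monic since [G`_0 = 1]. *)
Lemma hensel_reciprocal (G : {poly K}) :
  G`_0 = 1 -> G`_1 = 1 -> (forall i, (1 < i)%N -> G`_i \in m) ->
  exists t, root G t.
Proof.
move=> G0 G1 Gm.
have [k sG] : exists k, size G = k.+2.
  have: (1 < size G)%N.
    rewrite ltnNge; apply/negP => /leq_sizeP/(_ 1%N (leqnn _))/eqP.
    by rewrite G1 oner_eq0.
  by case: (size G) => [|[|k]] // _; exists k.
(* [R] is [X^(k+1) G(1/X)]: its two top coefficients are [G]_0 = G[_1 = 1], and [M] collects the
   others, all in the maximal ideal. *)
pose M := \poly_(j < k) G`_(k.+1 - j).
have Mm i : M`_i \in m.
  rewrite coef_poly; case: ifP => [ik|_]; last exact: vmax0.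
  by apply: Gm; rewrite ltn_subRL addn1.
pose R : {poly K} := 'X^(k.+1) + ('X^k + M).
have sM : (size M <= k)%N by apply: size_poly.
have monR : R \is monic.
  rewrite monicE lead_coefDl ?lead_coefXn // size_polyXn.
  by rewrite (leq_ltn_trans (size_polyD _ _)) // size_polyXn gtn_max ltnSn leqW.
have RA i : R`_i \in A.
  by rewrite !coefD !coefXn !rpredD ?rpred_nat ?(vmaxW _ _ (Mm i)).
have A1 : (-1 : K) \in A by rewrite rpredN rpred1.
have Rm : R.[-1] \in m.
  rewrite !hornerD !hornerXn exprS mulN1r addrA addNr add0r.
  exact: horner_vmax.
have Ru : (R^`()).[-1] \in U.
  rewrite /R !derivD !derivXn /= !hornerD !hornerMn !hornerXn addrA.
  apply: vunitDr => //; last first.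
    apply: horner_vmax => // i; rewrite coef_deriv.
    rewrite -mulr_natr vmaxMr ?rpred_nat //.
  (* For [k = 0] the truncated [k.-1] is harmless, its term having multiplicity 0. *)
  have -> : (-1) ^+ k *+ k.+1 + (-1) ^+ k.-1 *+ k = (-1) ^+ k :> K.
    case: k {sG M Mm R sM monR RA Rm} => [|k] /=; first by rewrite mulr0n addr0.
    rewrite mulrS exprS mulN1r -addrA mulNrn addNr addr0 //.
  by rewrite vunitX // vunitN vunit1.
have [s [As /rootP Rs /vmaxP ms]] :=
  A_hensel _ _ monR RA A1 (vmaxP _ _ _ Rm) (vunitP _ _ _ Ru).
have s0 : s != 0.
  apply: (@vunit_neq0 _ A); rewrite -[s](subrK (-1)) addrC.
  by apply: vunitDr; rewrite // vunitN vunit1.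
exists s^-1; apply/rootP; apply: (mulfI (expf_neq0 k.+1 s0)).
rewrite mulr0 -[RHS]Rs !hornerD !hornerXn horner_coef sG mulr_sumr.
have term (i : nat) : (i < k.+2)%N ->
    s ^+ k.+1 * (G`_i * s^-1 ^+ i) = G`_i * s ^+ (k.+1 - i).
  by move=> ik; rewrite mulrCA exprVn -expfB_cond // (negPf s0).
rewrite !big_ord_recl /= !term // G0 G1 !mul1r subn0 subn1 /=.
congr (_ + (_ + _)); rewrite horner_poly (reindex_inj rev_ord_inj) /=.
apply: eq_bigr => i _; rewrite term /bump //= ?add1n.
  by rewrite subnSK // subSS subKn ?subSn // ltnW.
by rewrite !ltnS subnSK // leq_subr.
Qed.

End Hensel.

(** * Domination of a polynomial by its constant term on small discs *)

Section Dominance.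
Variables (K : fieldType) (A : subringClosed K).
Hypothesis A_total : forall x, x != 0 -> x \in A \/ x^-1 \in A.
Hypothesis A_hensel : henselian A.
Local Notation m := (vmax K A).
Local Notation U := (vunit K A).

(** By Bezout 1 is a combination of [j] and [p], so both cannot lie in the maximal ideal. *)
Lemma vunit_nat p j : p%:R \in m -> coprime j p -> j%:R \in U.
Proof.
move=> mp; case: j => [|j] cop; last first.
  have /(vmax_or_vunit K A)/orP[mj|//] : (j.+1)%:R \in A by apply: rpred_nat.
  case: (egcdnP p (ltn0Sn j)) => u v /= e _.
  move: cop; rewrite /coprime => /eqP cop; rewrite cop in e.
  case: (vunit_not_vmax _ A 1 (vunit1 _ _)).
  have -> : 1 = (u * j.+1)%:R - (v * p)%:R :> K by rewrite e natrD addrC addKr.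
  by rewrite !natrM vmaxB // vmaxMl // rpred_nat.
move: cop mp; rewrite /coprime gcd0n => /eqP-> m1.
by case: (vunit_not_vmax _ A 1 (vunit1 _ _)).
Qed.

(* On the disc [c + d A] the constant term of [f] strictly dominates. *)
Definition dominant (f : {poly K}) (c d : K) :=
  f.[c] != 0 /\
  forall i, (0 < i)%N -> (f \Po (d *: 'X + c%:P))`_i / f.[c] \in m.

Lemma coef0_comp_affine (f : {poly K}) c d :
  (f \Po (d *: 'X + c%:P))`_0 = f.[c].
Proof. by rewrite -horner_coef0 horner_comp !hornerE. Qed.

Lemma dominant_quot f c d i :
  dominant f c d -> (f \Po (d *: 'X + c%:P))`_i / f.[c] \in A.
Proof.
case=> fc Hf; case: i => [|i]; last exact/vmaxW/Hf.
by rewrite coef0_comp_affine divff // rpred1.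
Qed.

(** In a product coefficient of positive index, each term has a factor of positive index. *)
Lemma dominantM f g c d :
  dominant f c d -> dominant g c d -> dominant (f * g) c d.
Proof.
move=> df dg; have [[fc Hf] [gc Hg]] := (df, dg).
split=> [|i i0]; first by rewrite hornerM mulf_neq0.
rewrite comp_polyM coefM hornerM mulr_suml vmax_sum // => j _.
rewrite invfM mulrACA; have [j0|j0] := posnP j.
  by rewrite vmaxMl ?dominant_quot // j0 subn0 Hg.
by rewrite vmaxMr ?dominant_quot // Hf.
Qed.

Lemma dominantC a c d : a != 0 -> dominant a%:P c d.
Proof.
move=> a0; split=> [|[|i] // _]; first by rewrite hornerC.
by rewrite comp_polyC coefC mul0r vmax0.
Qed.

(* The pairs [D c d] stand for the discs of center [c] and radius [v d], where
   [v d = v (theta - c)] for some [theta] immediate over [K]. *)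
Variable D : K -> K -> Prop.
Hypothesis D_neq0 : forall c d, D c d -> d != 0.
Hypothesis D_center : forall c, exists d, D c d.
Hypothesis D_dist : forall c d c' d',
  D c d -> D c' d' -> d' / d \in m -> (c' - c) / d \in U.
Hypothesis D_refine : forall c d, D c d -> exists c' d', D c' d' /\ d' / d \in m.

(** Here [d / d0 \in A] says that [v d >= v d0]: the property holds for all centers close enough to
    theta. *)
Definition eventually (P : K -> K -> Prop) :=
  exists c0 d0, D c0 d0 /\ forall c d, D c d -> d / d0 \in A -> P c d.

Lemma eventually_and P Q :
  eventually P -> eventually Q -> eventually (fun c d => P c d /\ Q c d).
Proof.
move=> [c1 [d1 [D1 HP]]] [c2 [d2 [D2 HQ]]].
have [d10 d20] := (D_neq0 _ _ D1, D_neq0 _ _ D2).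
have trans x y z : y != 0 -> x / y \in A -> y / z \in A -> x / z \in A.
  by move=> y0 xy yz; rewrite -(divfK y0 x) -(mulrA (x / y)) rpredM.
have [] := A_total (d1 / d2); first by rewrite mulf_neq0 ?invr_eq0.
  move=> d12; exists c1, d1; split=> // c d Dcd dd.
  by split; [apply: HP | apply: HQ => //; apply: (trans _ d1)].
rewrite invfM invrK mulrC => d21; exists c2, d2; split=> // c d Dcd dd.
by split; [apply: HP => //; apply: (trans _ d2) | apply: HQ].
Qed.

(** Once [c] is closer to theta than [r] is, [c - r] has the value of [theta - r], which is less
    than [v d]. *)
Lemma eventually_dominant_linear r : eventually (dominant ('X - r%:P)).
Proof.
have [e De] := D_center r; have [c0 [d0 [D0 de]]] := D_refine _ _ De.
exists c0, d0; split=> // c d Dcd dd0.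
have [e0 d00] := (D_neq0 _ _ De, D_neq0 _ _ D0).
have mde : d / e \in m by rewrite -(divfK d00 d) -(mulrA (d / d0)) vmaxMl.
have Ucr := D_dist _ _ _ _ De Dcd mde.
have cr : c - r != 0 by apply: contraTneq Ucr => ->; rewrite mul0r !inE eqxx.
split=> [|i i0]; first by rewrite !hornerE.
rewrite comp_polyB comp_polyX comp_polyC -addrA -polyCB coefD coefZ coefX coefC !hornerE.
case: i i0 => [|[|i]] // _; rewrite /= addr0; last by rewrite mulr0 mul0r vmax0.
rewrite mulr1 -(divfK e0 d) -(mulrA (d / e)) -[e / _]invf_div vmaxMr //.
by rewrite vunitW // vunitV.
Qed.

(** Compare coefficients in [(f \Po q)' = d (f' \Po q)] and divide by the index, which is a unit. *)
Lemma linear_term_dominates (f : {poly K}) c d :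
  (forall j, (0 < j < size f)%N -> j%:R \in U) -> d != 0 ->
  dominant f^`() c d ->
  forall i, (1 < i)%N ->
    (f \Po (d *: 'X + c%:P))`_i / (d * f^`().[c]) \in m.
Proof.
move=> Uj d0 [fc Hf] [|[|i]] // _; set q := d *: 'X + c%:P in Hf *.
have q' : q^`() = d%:P by rewrite derivD derivC derivZ derivX addr0 alg_polyC.
have sF : size (f \Po q) = size f.
  by rewrite size_comp_poly2 // size_polyDl size_scale ?size_polyX // ltnS size_polyC_leq1.
have [big|small] := leqP (size f) i.+2.
  by rewrite nth_default ?mul0r ?vmax0 // sF.
have Ui : i.+2%:R \in U by apply: Uj.
have i0 : i.+2%:R != 0 :> K by apply: vunit_neq0 Ui.
have : (f \Po q)^`()`_i.+1 = (f^`() \Po q)`_i.+1 * d.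
  by rewrite deriv_comp q' coefMC.
rewrite coef_deriv -mulr_natr => /(canRL (mulfK i0)) ->.
have -> : (f^`() \Po q)`_i.+1 * d / i.+2%:R / (d * f^`().[c]) =
          (f^`() \Po q)`_i.+1 / f^`().[c] * i.+2%:R^-1.
  by move: (i.+2%:R) i0 => z z0; field; rewrite fc d0 z0.
by rewrite vmaxMr ?Hf // vunitW // vunitV.
Qed.

(** If the linear coefficient [F1] is not dominated by [f.[c]], then [t = f.[c] / F1] is in [A], and
    [F(t X) / f.[c]] has the shape required by [hensel_reciprocal]; its root yields one of [f]. *)
Lemma dominant_or_root (f : {poly K}) c d :
  (forall j, (0 < j < size f)%N -> j%:R \in U) -> d != 0 ->
  dominant f^`() c d -> dominant f c d \/ exists r, root f r.
Proof.
move=> Uj d0 df'; have Hlin := linear_term_dominates _ _ _ Uj d0 df'.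
have [fc' _] := df'.
have [fc0|fc] := eqVneq f.[c] 0; first by right; exists c; apply/rootP.
set q := d *: 'X + c%:P in Hlin; pose F := f \Po q; pose F1 := d * f^`().[c].
have F10 : F1 != 0 by rewrite mulf_neq0.
have F1E : F`_1 = F1.
  have := coef_deriv F 0; rewrite mulr1n => <-.
  rewrite deriv_comp derivD derivC derivZ derivX addr0 alg_polyC coefMC.
  by rewrite coef0_comp_affine mulrC.
have F0E : F`_0 = f.[c] by apply: coef0_comp_affine.
have [m1|nm1] := boolP (F1 / f.[c] \in m); [left | right].
  split=> // -[|[|i]] // _; first by rewrite -/F F1E.
  by rewrite -[X in X / _](divfK F10) -(mulrA (_ / F1)) vmaxMr ?(vmaxW _ _ m1) // Hlin.
pose t := f.[c] / F1.
have At : t \in A.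
  have [/(vmax_or_vunit K A)/orP[|]|/(vmaxV_notin K A A_total)/vmaxW] :=
    boolP (F1 / f.[c] \in A).
  - by rewrite (negPf nm1).
  - by rewrite -vunitV invf_div => /vunitW.
  - by rewrite invf_div.
have t0 : t != 0 by rewrite mulf_neq0 ?invr_eq0.
pose G := \poly_(i < size F) (F`_i * t ^+ i / f.[c]).
have GE i : G`_i = F`_i * t ^+ i / f.[c].
  by rewrite coef_poly; case: ltnP => // /(nth_default _)->; rewrite !mul0r.
have [||[|[|i]] // _|y /rootP Gy] := hensel_reciprocal K A A_total A_hensel G.
- by rewrite GE F0E mulr1 divff.
- by rewrite GE F1E /t; field; rewrite fc F10.
- rewrite GE.
  have -> : F`_i.+2 * t ^+ i.+2 / f.[c] = F`_i.+2 / F1 * t ^+ i.+1.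
    by rewrite (exprS t i.+1) /t; field; rewrite fc F10.
  by rewrite vmaxMr ?rpredX // Hlin.
exists (d * (t * y) + c); apply/rootP.
have -> : f.[d * (t * y) + c] = F.[t * y] by rewrite horner_comp !hornerE.
apply: (mulIf (invr_neq0 fc)); rewrite mul0r -Gy horner_poly horner_coef mulr_suml.
by apply: eq_bigr => i _; rewrite exprMn; ring.
Qed.

(** Induction on a bound for the size: a root of [f] splits off a linear factor; without a root,
    domination passes from [f'] to [f]. *)
Lemma eventually_dominant (f : {poly K}) :
  (forall j, (0 < j < size f)%N -> j%:R \in U) -> f != 0 ->
  eventually (dominant f).
Proof.
move: {2}(size f) (leqnn (size f)) => n; elim: n f => [|n IH] f sf Uj f0.
  by move: sf; rewrite leqn0 size_poly_eq0 (negPf f0).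
have [f1|f1] := leqP (size f) 1.
  have [d Dd] := D_center 0; exists 0, d; split=> // c d' _ _.
  by rewrite (size1_polyC f1); apply: dominantC; rewrite -polyC_eq0 -size1_polyC.
have [[r /factor_theorem[g fE]]|noroot] := EM (exists r, root f r).
  have g0 : g != 0 by apply: contraNneq f0 => g0; rewrite fE g0 mul0r.
  have sg : size f = (size g).+1 by rewrite fE size_Mmonic ?monicXsubC // size_XsubC addn2.
  have [||c0 [d0 [D0 H]]] := eventually_and _ _ (IH g _ _ g0) (eventually_dominant_linear r).
  - by rewrite -ltnS -sg.
  - by move=> j /andP[j0 jg]; apply: Uj; rewrite j0 sg ltnW.
  exists c0, d0; split=> // c d Dcd dd; rewrite fE.
  by have [] := H _ _ Dcd dd; apply: dominantM.
have [|||c0 [d0 [D0 H]]] := IH f^`().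
- by rewrite -ltnS (leq_trans (lt_size_deriv f0)).
- move=> j /andP[j0 jf]; apply: Uj; rewrite j0.
  exact: ltn_trans jf (lt_size_deriv f0).
(* The top coefficient of [f'] is that of [f] times the degree, which is a unit. *)
- apply/eqP => f'0; have := coef_deriv f (size f).-2.
  rewrite f'0 coef0 => /esym/eqP.
  rewrite -mulr_natr mulf_eq0 prednK -?subn1 ?subn_gt0 // subn1.
  rewrite -lead_coefE lead_coef_eq0 (negPf f0) /=; apply/negP.
  apply: (@vunit_neq0 _ A); apply: Uj.
  by rewrite -ltnS prednK ?leqnn ?(ltnW f1) // f1.
exists c0, d0; split=> // c d Dcd dd.
by have [|/noroot] := dominant_or_root f c d Uj (D_neq0 _ _ Dcd) (H _ _ Dcd dd).
Qed.

End Dominance.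

(** * The integral closure of a subring of K as a subring of L *)

Section SubringType.
Variables (K : fieldType) (S : subringClosed K).

(** A ring type for [S], since [integralOver] speaks of a ring morphism. *)
Record subring_type := SubringType {subring_val : K; _ : subring_val \in S}.
HB.instance Definition _ := [isSub for subring_val].
HB.instance Definition _ := [Choice of subring_type by <:].
HB.instance Definition _ := [SubChoice_isSubComNzRing of subring_type by <:].

End SubringType.

Section IntegralClosure.
Variables (K : fieldType) (L : fieldExtType K) (A : subringClosed K).

(** Gives access to the known closure of integral elements under differences and products. *)
Lemma integral_closureP (x : L) :
  integral_closure A x <-> integralOver (in_alg L \o (val : subring_type K A -> K)) x.
Proof.
split=> [[q [mq qA qx]]|[q mq qx]].
  have qE : map_poly val (\poly_(i < size q) SubringType K A q`_i (qA i)) = q.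
    apply/polyP => i; rewrite coef_map coef_poly; case: ltnP => //= sq.
    by rewrite nth_default.
  exists (\poly_(i < size q) SubringType K A q`_i (qA i)); last by rewrite map_poly_comp qE.
  apply/eqP/val_inj; rewrite -lead_coef_map_inj ?qE ?rmorph0 //; last exact: val_inj.
  by rewrite (eqP mq) rmorph1.
exists (map_poly val q); split; last by rewrite -map_poly_comp.
  exact: monic_map.
by move=> i; rewrite coef_map; apply: valP.
Qed.

Definition icl : {pred L} := fun x => `[< integral_closure A x >].

Lemma iclP x : reflect (integral_closure A x) (x \in icl).
Proof. exact: asboolP. Qed.

Fact icl_subring_closed : subring_closed icl.
Proof.
split=> [|x y /iclP/integral_closureP ix /iclP/integral_closureP iy|
          x y /iclP/integral_closureP ix /iclP/integral_closureP iy];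
  apply/iclP/integral_closureP.
- exact: integral1.
- exact: integral_sub.
- exact: integral_mul.
Qed.
HB.instance Definition _ := GRing.isSubringClosed.Build L icl icl_subring_closed.

Lemma icl_algid (a : K) : a \in A -> a%:A \in icl.
Proof.
move=> Aa; apply/iclP; exists ('X - a%:P); split; first exact: monicXsubC.
  by move=> i; rewrite coefB coefX coefC rpredB ?rpred_nat //; case: eqP; rewrite ?rpred0.
by rewrite map_polyXsubC root_XsubC.
Qed.

Hypothesis A_total : forall x, x != 0 -> x \in A \/ x^-1 \in A.

(* Valuation rings are integrally closed: if [a] is not in [A], divide the
   integral equation of [a] by a power of [a]. *)
Lemma icl_alg (a : K) : (a%:A \in icl) = (a \in A).
Proof.
apply/idP/idP => [/iclP[q [mq qA qx]]|]; last exact: icl_algid.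
have [//|nAa] := boolP (a \in A).
have a0 : a != 0 by apply: contraNneq nAa => ->; rewrite rpred0.
have Aa' : a^-1 \in A by case: (A_total a a0) => // Aa; rewrite Aa in nAa.
have /rootP : root q a by move: qx; rewrite -[a%:A]/(in_alg L a) fmorph_root.
have q1 : (0 < size q)%N by rewrite size_poly_gt0 monic_neq0.
rewrite horner_coef -(prednK q1) big_ord_recr /= -lead_coefE (eqP mq) mul1r.
move/(canRL (addKr _)); rewrite addr0 => aE.
case: (size q).-1 aE => [|n] aE.
  by move/eqP: aE; rewrite big_ord0 oppr0 expr0 oner_eq0.
case/negP: nAa; suff -> : a = - \sum_(i < n.+1) q`_i * a^-1 ^+ (n - i).
  by rewrite rpredN rpred_sum // => i _; rewrite rpredM ?rpredX.
apply: (mulIf (expf_neq0 n a0)); rewrite -exprS aE mulNr mulr_suml.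
congr (- _); apply: eq_bigr => i _; rewrite -mulrA; congr (_ * _).
have ni : (i <= n)%N by rewrite -ltnS.
have := exprD a (n - i) i; rewrite subnK // => ->.
by rewrite mulrA -exprMn mulVf // expr1n mul1r.
Qed.

Lemma vunit_alg (a : K) : (a%:A \in vunit L icl) = (a \in vunit K A).
Proof.
rewrite [LHS]inE [RHS]inE -[a%:A]/(in_alg L a) -fmorphV fmorph_eq0.
by rewrite ![in_alg L _ \in _]icl_alg.
Qed.

Lemma vmax_alg (a : K) : (a%:A \in vmax L icl) = (a \in vmax K A).
Proof. by rewrite [LHS]inE [RHS]inE vunit_alg icl_alg. Qed.

End IntegralClosure.

(** * Generators of a Kummer extension of prime degree *)

Section KummerGenerators.
Variables (K : fieldType) (L : fieldExtType K) (p : nat) (zeta : K).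
Hypotheses (p_pr : prime p) (zeta_prim : p.-primitive_root zeta).
Hypothesis dimL : \dim {:L} = p.

Definition generates (x : L) := <<1; x>>%VS = fullv.

Lemma generates_degree x : generates x -> adjoin_degree 1 x = p.
Proof. by rewrite adjoin_degreeE dimv1 divn1 => ->. Qed.

Lemma generates_span x y : generates x ->
  exists2 f : {poly K}, (size f <= p)%N & y = (map_poly (in_alg L) f).[x].
Proof.
move=> gx; have yx : y \in <<1; x>>%VS by rewrite gx memvf.
have /polyOver1P[f fE] := Fadjoin_polyOver 1 x y.
exists f; last by rewrite -fE Fadjoin_poly_eq.
by rewrite -(size_map_poly (in_alg L)) -fE -(generates_degree x) // size_Fadjoin_poly.
Qed.

(** The minimal polynomial of [x] has degree [p]. *)
Lemma generates_free x (f : {poly K}) :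
  generates x -> (size f <= p)%N -> (map_poly (in_alg L) f).[x] = 0 -> f = 0.
Proof.
move=> gx sf /rootP fx; apply/eqP; rewrite -(map_poly_eq0 (in_alg L)).
rewrite -(@root_small_adjoin_poly _ _ 1%AS x) ?generates_degree ?size_map_poly //.
by apply/polyOver1P; exists f.
Qed.

Lemma generates_not_alg x a : generates x -> x != a%:A.
Proof.
move=> gx; apply/eqP => xa.
have /eqP : 'X - a%:P = 0 :> {poly K}; last by rewrite polyXsubC_eq0.
apply: (generates_free x) => //; first by rewrite size_XsubC prime_gt1.
by rewrite map_polyXsubC hornerXsubC xa subrr.
Qed.

Lemma generates_neq0 x : generates x -> x != 0.
Proof. by move=> /(generates_not_alg x 0); rewrite scale0r. Qed.

Lemma generatesZ x a : a != 0 -> generates x -> generates (a%:A * x).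
Proof.
move=> a0 gx; apply/eqP; rewrite eqEsubv subvf /= -gx.
apply/FadjoinP; split; first exact: subv_adjoin.
have : a^-1 *: (a%:A * x) \in <<1; a%:A * x>>%VS by rewrite rpredZ ?memv_adjoin.
by rewrite mulr_algl scalerK.
Qed.

Lemma prime_root_quot (x y : L) :
  y != 0 -> x ^+ p = y ^+ p -> exists i : nat, x = (zeta ^+ i)%:A * y.
Proof.
move=> y0 xy; have pz : p.-primitive_root (in_alg L zeta)
    by rewrite fmorph_primitive_root.
have [|i xyE] := prim_rootP pz (_ : (x / y) ^+ p = 1).
  by rewrite expr_div_n xy divff // expf_neq0.
by exists i; rewrite -[LHS](divfK y0) xyE -rmorphXn.
Qed.

Lemma zeta_neq0 : zeta != 0.
Proof. by rewrite (prim_root_eq0 zeta_prim) -lt0n prime_gt0. Qed.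

(** [kummer_gen] provides one generating root; any other differs from it by a power of [zeta], a
    nonzero scalar. *)
Lemma kummer_gen_generates (x : L) h : kummer_gen L p h -> x ^+ p = h%:A -> generates x.
Proof.
move=> [y [yh gy]] xh; have [||i ->] := prime_root_quot x y.
- exact: generates_neq0.
- by rewrite xh yh.
- by apply: generatesZ; rewrite // expf_neq0 // zeta_neq0.
Qed.

(** Otherwise the generating root would be [zeta ^+ i * b], an element of K. *)
Lemma kummer_gen_not_power h b : kummer_gen L p h -> h != b ^+ p.
Proof.
move=> kh; have [x [xh gx]] := kh; apply/eqP => hb.
have b0 : b != 0.
  apply: contraNneq (generates_neq0 x gx) => b0.
  have : x ^+ p == 0 by rewrite xh hb b0 expr0n eqn0Ngt prime_gt0 // scale0r.
  by rewrite expf_eq0 => /andP[].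
have [||i xE] := prime_root_quot x b%:A.
- by rewrite scaler_eq0 negb_or b0 oner_eq0.
- by rewrite xh hb -!in_algE rmorphXn.
by case/eqP: (generates_not_alg x (zeta ^+ i * b) gx); rewrite xE -!in_algE rmorphM.
Qed.

(* If [x = a(y)] with [a] of degree less than [p], then [a(zeta y)] is another
   [p]-th root of [x ^+ p], hence equals [zeta ^+ k * a(y)]; comparing
   coefficients, [a] is a monomial of degree [k]. *)
Lemma kummer_generators x y g h :
  generates x -> generates y -> x ^+ p = g%:A -> y ^+ p = h%:A ->
  exists d i, [/\ (0 < i < p)%N, d != 0 & x = d%:A * y ^+ i].
Proof.
move=> gx gy xg yh; have x0 := generates_neq0 x gx.
have [a sa xa] := generates_span y x gy.
pose Q : {poly K} := 'X^p - h%:P; pose P := a ^+ p - g%:P.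
have p0 := prime_gt0 p_pr.
have sQ : size Q = p.+1 by rewrite size_XnsubC.
have Q0 : Q != 0 by rewrite -size_poly_eq0 sQ.
have evP z : (map_poly (in_alg L) P).[z] = (map_poly (in_alg L) a).[z] ^+ p - g%:A.
  by rewrite rmorphB rmorphXn /= map_polyC !hornerE.
have evQ z : (map_poly (in_alg L) Q).[z] = z ^+ p - h%:A.
  by rewrite rmorphB /= map_polyXn map_polyC !hornerE.
clearbody P Q.
(* The remainder has degree less than [p] and vanishes at [y], so it is zero. Hence [P] also
   vanishes at the conjugate [zeta y]. *)
have QP : Q %| P.
  apply/eqP; apply: (generates_free y) => //.
    by rewrite -ltnS -sQ ltn_modpN0.
  have /(congr1 (fun f => (map_poly (in_alg L) f).[y])) := divp_eq P Q.
  rewrite rmorphD rmorphM /= hornerD hornerM evP evQ yh subrr mulr0 add0r => <-.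
  by rewrite -xa xg subrr.
have zx : (map_poly (in_alg L) a).[zeta%:A * y] ^+ p = x ^+ p.
  apply/eqP; rewrite xg -subr_eq0 -evP -(divpK QP) rmorphM hornerM /= evQ.
  by rewrite exprMn yh -in_algE -rmorphXn /= prim_expr_order // scale1r mul1r subrr mulr0.
have [j zxE] := prime_root_quot _ _ x0 zx.
pose k := (j %% p)%N; have kp : (k < p)%N by rewrite ltn_mod.
rewrite -(prim_expr_mod zeta_prim) -/k in zxE.
have b0 : \poly_(i < p) (a`_i * (zeta ^+ i - zeta ^+ k)) = 0 :> {poly K}.
  apply: (generates_free y _ gy); first exact: size_poly.
  rewrite (@horner_coef_wide _ p) ?size_map_poly ?size_poly //.
  move/eqP: zxE; rewrite -subr_eq0 xa !(@horner_coef_wide _ p (map_poly _ a)) ?size_map_poly //.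
  rewrite mulr_sumr -sumrB => /eqP E; rewrite -[RHS]E; apply: eq_bigr => i _.
  rewrite !coef_map coef_poly ltn_ord /= -!in_algE rmorphM rmorphB !rmorphXn exprMn.
  by ring.
have ak i : (i < p)%N -> i != k -> a`_i = 0.
  move=> ip ik; have /polyP/(_ i)/eqP := b0; rewrite coef_poly ip coef0 mulf_eq0.
  rewrite subr_eq0 (eq_prim_root_expr zeta_prim) !modn_small // (negPf ik) orbF.
  by move/eqP.
have xE : x = (a`_k)%:A * y ^+ k.
  rewrite {1}xa (@horner_coef_wide _ p) ?size_map_poly // (bigD1 (Ordinal kp)) //=.
  rewrite coef_map big1 ?addr0 // => i ik; rewrite coef_map /= ak ?scale0r ?mul0r //.
exists a`_k, k; split=> //; last by apply: contraNneq x0 => ak0; rewrite xE ak0 scale0r mul0r.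
rewrite kp lt0n andbT; apply: contraTneq (generates_not_alg x (a`_k) gx) => k0.
by rewrite negbK {1}xE k0 mulr1.
Qed.

End KummerGenerators.

(** * Powers of exponent p and roots of unity in residue characteristic p *)

Section ResidueCharacteristic.
Variables (F : fieldType) (V : subringClosed F) (p : nat).
Hypothesis V_total : forall x, x != 0 -> x \in V \/ x^-1 \in V.
Hypotheses (p_pr : prime p) (p_max : p%:R \in vmax F V).


(** The inner binomial coefficients are divisible by [p], with quotients [s j]; [s 0 = 1] later
    makes the sum a unit at [zeta - 1]. *)
Lemma exprD1_prime (x : F) : exists2 s : nat -> nat,
  (s 0 = 1)%N & (x + 1) ^+ p = x ^+ p + 1 + p%:R * x * \sum_(j < p.-1) x ^+ j *+ s j.
Proof.
have p1 := prime_gt1 p_pr; exists (fun j => 'C(p, j.+1) %/ p)%N.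
  by rewrite bin1 divnn prime_gt0.
rewrite exprD1n; case: p p_pr p1 => [|[|n]] // n_pr _.
rewrite big_ord_recl big_ord_recr /= bin0 binn mulr1n expr0 mulr_sumr.
rewrite mulr1n [X in 1 + X]addrC addrA [1 + _]addrC /bump add1n; congr (_ + _).
apply: eq_bigr => j _; rewrite add1n.
have /divnK {1}<- : (n.+2 %| 'C(n.+2, j.+1))%N.
  by apply: prime_dvd_bin => //=; apply: ltn_ord j.
by rewrite exprS mulrnA -[LHS]mulr_natl -mulrA mulrnAr.
Qed.

(** Modulo [p], [(x - 1) ^+ p] is [x ^+ p - 1], and the maximal ideal is radical. *)
Lemma expr_prime_one_unit x : x \in V ->
  (x ^+ p - 1 \in vmax F V) = (x - 1 \in vmax F V).
Proof.
move=> Vx; have Vx1 : x - 1 \in V by rewrite rpredB ?rpred1.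
apply/idP/idP => [mx|mx]; last first.
  by rewrite subrX1 vmaxMr // rpred_sum // => i _; rewrite rpredX.
apply: (vmax_radical _ _ _ p) => //.
have [s _] := exprD1_prime (x - 1); rewrite subrK => E.
have -> : (x - 1) ^+ p = x ^+ p - 1 - p%:R * (x - 1) * \sum_(j < p.-1) (x - 1) ^+ j *+ s j.
  by rewrite E; ring.
rewrite vmaxB // -mulrA vmaxMr // rpredM // rpred_sum // => j _.
by rewrite rpredMn // rpredX.
Qed.

Variable zeta : F.
Hypotheses (zeta_prim : p.-primitive_root zeta) (p_neq0 : p%:R != 0 :> F).

Lemma zeta_valring : zeta \in V.
Proof.
apply: contraT => /(vmaxV_notin _ _ V_total)/(vmaxX _ _ _ p)/(_ (prime_gt0 p_pr)).
rewrite exprVn prim_expr_order // invr1 => m1.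
by case: (vunit_not_vmax _ V 1 (vunit1 _ _)).
Qed.

Lemma zeta_sub1_vmax : zeta - 1 \in vmax F V.
Proof.
by rewrite -expr_prime_one_unit ?zeta_valring // prim_expr_order // subrr vmax0.
Qed.

Lemma zeta_sub1_neq0 : zeta - 1 != 0.
Proof.
rewrite subr_eq0 -[zeta]expr1 -(prim_order_dvd zeta_prim) gtnNdvd //.
exact: prime_gt1.
Qed.

(* Cancelling [zeta - 1] in the expansion of [(1 + (zeta - 1)) ^+ p = 1]. *)
Lemma zeta_sub1_expr : p%:R / (zeta - 1) ^+ p.-1 \in vunit F V.
Proof.
set z := zeta - 1; have mz : z \in vmax F V := zeta_sub1_vmax.
have z0 : z != 0 := zeta_sub1_neq0; have p1 := prime_gt1 p_pr.
have [s s0] := exprD1_prime z; rewrite /z subrK prim_expr_order // -/z.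
set S := \sum_(j < _) _ => E.
have US : S \in vunit F V.
  rewrite /S; case: p p1 => [|[|n]] //= _; rewrite big_ord_recl s0 mulr1n.
  apply: vunitDr => //; first exact: vunit1.
  apply: vmax_sum => // j _; rewrite -mulr_natr vmaxMr ?rpred_nat //.
  by rewrite vmaxX.
have zE : z ^+ p.-1 = - p%:R * S.
  apply: (mulfI z0); rewrite -exprS prednK ?prime_gt0 //.
  apply/eqP; rewrite -subr_eq0; apply/eqP.
  have -> : z ^+ p - z * (- p%:R * S) = z ^+ p + 1 + p%:R * z * S - 1 by ring.
  by rewrite -E subrr.
by rewrite zE invfM mulrCA invrN mulNr mulKf // vunitN vunitV.
Qed.

Lemma horner_sub_vmax (q : {poly F}) x y :
  (forall i, q`_i \in V) -> x \in V -> y \in V -> x - y \in vmax F V ->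
  q.[x] - q.[y] \in vmax F V.
Proof.
move=> Vq Vx Vy mxy; rewrite !horner_coef -sumrB vmax_sum // => i _.
rewrite -mulrBr vmaxMl // subrXX vmaxMr // rpred_sum // => j _.
by rewrite rpredM ?rpredX.
Qed.

End ResidueCharacteristic.

(** * The valuation ring of L and the approximation of generators from K *)

Section DefectKummer.
Variables (K : fieldType) (L : fieldExtType K) (A : subringClosed K).
Variables (p : nat) (zeta : K).
Hypothesis A_total : forall x, x != 0 -> x \in A \/ x^-1 \in A.
Hypothesis A_hensel : henselian A.
Hypotheses (p_pr : prime p) (p_max : p%:R \in vmax K A).
Hypotheses (zeta_prim : p.-primitive_root zeta) (p_neq0 : p%:R != 0 :> K).
Hypothesis dimL : \dim {:L} = p.
Local Notation B := (icl K L A).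
Local Notation mA := (vmax K A).
Local Notation UA := (vunit K A).
Local Notation mB := (vmax L B).
Local Notation UB := (vunit L B).
(** [unramified] expresses [e = 1], and [residual] expresses [f = 1]. *)
Hypothesis unramified : forall y : L, y != 0 ->
  exists c : K, c != 0 /\ y / c%:A \in UB.
Hypothesis residual : forall b : L, b \in B ->
  exists a : K, a \in A /\ b - a%:A \in mB.
Local Notation gen := (generates K L).
Local Notation z := (zeta - 1).

(** Up to a unit of [B], [x] is an element of K; so [B] is a valuation ring and the earlier lemmas
    apply to it. *)
Lemma icl_total (x : L) : x != 0 -> x \in B \/ x^-1 \in B.
Proof.
move=> x0; have [c [c0 Uc]] := unramified x x0.
have cA0 : c%:A != 0 :> L by rewrite scaler_eq0 (negPf c0) oner_eq0.
have [Ac|Ac] := A_total c c0; [left | right].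
  by rewrite -(divfK cA0 x) rpredM ?icl_algid ?(vunitW _ _ Uc).
rewrite -(divfK cA0 x) invfM rpredM //; first by rewrite (vunitW L) // vunitV.
by rewrite -in_algE -fmorphV icl_algid.
Qed.

Lemma icl_horner (q : {poly K}) (x : L) :
  (forall i, q`_i \in A) -> x \in B -> (map_poly (in_alg L) q).[x] \in B.
Proof.
by move=> Aq Bx; apply: horner_valring => // i; rewrite coef_map icl_algid.
Qed.

Definition radius (theta : L) (c d : K) :=
  d != 0 /\ (theta - c%:A) / d%:A \in UB.

Section Radius.
Variable theta : L.
Hypothesis theta_gen : gen theta.
Local Notation D := (radius theta).

Lemma radius_center c : exists d, D c d.
Proof.
have [|d [d0 Ud]] := unramified (theta - c%:A); last by exists d.
by rewrite subr_eq0 (generates_not_alg K L p p_pr dimL).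
Qed.

(** As [c'] is closer to theta than [c], [c' - c] and [theta - c] have the same value. *)
Lemma radius_dist c d c' d' :
  D c d -> D c' d' -> d' / d \in mA -> (c' - c) / d \in UA.
Proof.
move=> [d0 Ud] [d'0 Ud'] mdd; rewrite -(vunit_alg K L A A_total).
have -> : ((c' - c) / d)%:A =
    (theta - c%:A) / d%:A - (theta - c'%:A) / d'%:A * (d' / d)%:A :> L.
  rewrite -!in_algE !(rmorphM, rmorphB, fmorphV) /=.
  have : in_alg L d != 0 /\ in_alg L d' != 0 by rewrite !fmorph_eq0.
  by rewrite /= => -[dn d'n]; field; rewrite dn d'n.
apply: vunitDr => //; first exact: icl_total.
by rewrite vmaxN vmaxMl ?(vunitW _ _ Ud') // vmax_alg.
Qed.

(** With [a] in the residue class of [(theta - c) / d], the center [c + d * a] is strictly closer to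
    theta. *)
Lemma radius_refine c d : D c d -> exists c' d', D c' d' /\ d' / d \in mA.
Proof.
move=> [d0 Ud]; have [a [Aa ma]] := residual _ (vunitW _ _ Ud).
have [d' Dd'] := radius_center (c + d * a); exists (c + d * a), d'; split=> //.
have [d'0 Ud'] := Dd'; rewrite -(vmax_alg K L A A_total).
have /vunit_neq0 u0 := Ud'.
have -> : (d' / d)%:A =
    ((theta - (c + d * a)%:A) / d'%:A)^-1 * ((theta - c%:A) / d%:A - a%:A).
  move: u0; rewrite mulf_eq0 => /norP[+ _].
  rewrite -!in_algE !(rmorphM, rmorphD, fmorphV) /= => u0.
  have : in_alg L d != 0 /\ in_alg L d' != 0 by rewrite !fmorph_eq0.
  by rewrite /= => -[dn d'n]; field; rewrite dn d'n.
by rewrite vmaxMl // (vunitW L) // vunitV.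
Qed.

Lemma horner_comp_affine (f : {poly K}) c d : d != 0 ->
  (map_poly (in_alg L) (f \Po (d *: 'X + c%:P))).[(theta - c%:A) / d%:A] =
  (map_poly (in_alg L) f).[theta].
Proof.
move=> d0; rewrite map_comp_poly horner_comp; congr (_.[_]).
rewrite rmorphD /= map_polyZ map_polyX map_polyC !hornerE /=.
by rewrite mulrC mulKf ?subrK // scaler_eq0 (negPf d0) oner_eq0.
Qed.

(** [G = F / f.[c]] is 1 modulo the maximal ideal, so [G(u)] is a unit and [f.[c] = F(u) / G(u)] is
    integral; the other coefficients are multiples of [f.[c]]. *)
Lemma dominant_integral (f : {poly K}) c d : D c d -> dominant K A f c d ->
  (map_poly (in_alg L) f).[theta] \in B ->
  forall i, (f \Po (d *: 'X + c%:P))`_i \in A.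
Proof.
move=> [d0 Ud] domf; set F := f \Po _; rewrite -(horner_comp_affine _ c d) // -/F.
set u := (theta - _) / _ in Ud *; move=> Bf; have [fc Hf] := domf.
pose G := f.[c]^-1 *: F.
have Gm i : (G - 1)`_i \in mA.
  rewrite coefB coefZ coef1 mulrC; case: i => [|i] /=; last by rewrite subr0 Hf.
  by rewrite coef0_comp_affine divff // subrr vmax0.
have UG : (map_poly (in_alg L) G).[u] \in UB.
  rewrite -[G](subrK 1) addrC rmorphD rmorph1 hornerD hornerC.
  apply: vunitDr; [exact: icl_total | exact: vunit1 |].
  apply: horner_vmax; [exact: icl_total | | exact: vunitW Ud].
  by move=> i; rewrite coef_map (vmax_alg K L A A_total).
have Afc : f.[c] \in A.
  rewrite -(icl_alg K L A A_total).
  have -> : (f.[c])%:A = (map_poly (in_alg L) F).[u] / (map_poly (in_alg L) G).[u].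
    have := vunit_neq0 _ _ UG; rewrite map_polyZ hornerZ mulf_eq0 => /norP[_ F0].
    by rewrite invfM mulrCA divff // mulr1 fmorphV invrK.
  by rewrite rpredM // (vunitW L) // vunitV.
by move=> i; rewrite -(divfK fc F`_i) rpredM // dominant_quot.
Qed.

End Radius.

(** * The set S and the rings generated by the elements alpha' *)

Definition in_Ap (h : K) :=
  [/\ kummer_gen L p h, unit_in (memA A) h & maxideal_in (memA A) (h - 1)].
Definition in_S (alpha : L) := exists h : K, in_Ap h /\ alpha ^+ p = h%:A.

Lemma in_SP alpha : in_S alpha <->
  [/\ gen alpha, alpha - 1 \in mB & exists h, alpha ^+ p = h%:A].
Proof.
have pB : p%:R \in mB.
  by rewrite -(rmorph_nat (in_alg L)) (vmax_alg K L A A_total).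
split=> [[h [[kh /vunitP Uh /vmaxP mh] ah]]|[ga ma [h ah]]].
  have Ba : alpha \in B.
    apply/iclP; exists ('X^p - h%:P); split.
    - exact/monicXnsubC/prime_gt0.
    - move=> i; rewrite coefB coefXn coefC rpredB ?rpred_nat //.
      by case: eqP; rewrite ?rpred0 // (vunitW _ _ Uh).
    - by rewrite rmorphB /= map_polyXn map_polyC; apply/rootP; rewrite !hornerE ah subrr.
  split; [exact: (kummer_gen_generates K L p zeta) ah | | by exists h].
  rewrite -(expr_prime_one_unit L B p icl_total p_pr pB) // ah.
  have -> : h%:A - 1 = (h - 1)%:A :> L by rewrite scalerBl scale1r.
  by rewrite (vmax_alg K L A A_total).
have Ba : alpha \in B by rewrite -(subrK 1 alpha) rpredD ?rpred1 ?(vmaxW _ _ ma).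
have mh : h - 1 \in mA.
  rewrite -(vmax_alg K L A A_total) scalerBl scale1r -ah.
  by rewrite (expr_prime_one_unit L B p icl_total p_pr pB).
exists h; split=> //; split; [by exists alpha | | exact/vmaxP].
by apply/vunitP; rewrite -(subrK 1 h) addrC; apply: vunitDr; rewrite ?vunit1.
Qed.

(** Divide a Kummer generator by [c] to reach value 0, then by [a] to reach residue 1. *)
Lemma in_S_exists h : kummer_gen L p h -> exists alpha, in_S alpha.
Proof.
move=> [theta [th gth]].
have th0 := generates_neq0 K L p p_pr dimL theta gth.
have [c [c0 Uc]] := unramified theta th0.
have [a [Aa ma]] := residual _ (vunitW _ _ Uc).
have Ua : a%:A \in UB.
  rewrite -[a%:A](subKr (theta / c%:A)); apply: vunitDr; rewrite ?vmaxN //.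
  exact: icl_total.
have a0 : a != 0 by have := vunit_neq0 _ _ Ua; rewrite scaler_eq0 oner_eq0 orbF.
have aA0 := vunit_neq0 _ _ Ua.
exists ((c * a)^-1%:A * theta); apply/in_SP; split.
- by apply: generatesZ; rewrite // invr_eq0 mulf_neq0.
- have -> : (c * a)^-1%:A * theta - 1 = (theta / c%:A - a%:A) / a%:A.
    rewrite mulrBl divff // -!in_algE fmorphV rmorphM invfM /=.
    by congr (_ - _); rewrite mulrC mulrA.
  by rewrite vmaxMr // (vunitW L) // vunitV.
- by exists ((c * a)^-1 ^+ p * h); rewrite exprMn th -!in_algE rmorphM rmorphXn.
Qed.

(* Otherwise [x = (alpha - 1) / (zeta - 1)] is an integral root of
   [((zeta - 1) X + 1) ^+ p - h] divided by [(zeta - 1) ^+ p], a monic polynomial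
   whose derivative is a unit on [A]; by Hensel it has a root in [K]. *)
Lemma in_S_distance alpha : in_S alpha -> (alpha - 1) / z%:A \notin B.
Proof.
move=> [h [[kh _ _] ah]]; set x := (alpha - 1) / _; apply/negP => Bx.
have z0 := zeta_sub1_neq0 K p p_pr zeta zeta_prim.
have mz := zeta_sub1_vmax K A p A_total p_pr p_max zeta zeta_prim.
have Uz := zeta_sub1_expr K A p A_total p_pr p_max zeta zeta_prim p_neq0.
have p0 := prime_gt0 p_pr.
pose f : {poly K} := (z ^+ p)^-1 *: ((z *: 'X + 1) ^+ p - h%:P).
have coef_pow i : ((z *: 'X + 1) ^+ p)`_i = z ^+ i *+ 'C(p, i).
  have -> : (z *: 'X + 1) ^+ p = \poly_(j < p.+1) (z ^+ j *+ 'C(p, j)).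
    rewrite exprD1n poly_def; apply: eq_bigr => j _.
    by rewrite exprZn scalerMnl.
  by rewrite coef_poly ltnS; case: leqP => // /bin_small->; rewrite mulr0n.
have fE i : (0 < i)%N -> f`_i = z ^+ i *+ 'C(p, i) / z ^+ p.
  by move=> i0; rewrite coefZ coefB coef_pow coefC gtn_eqF // subr0 mulrC.
have fp : f`_p = 1 by rewrite fE // binn mulr1n divff // expf_neq0.
have sf : size f = p.+1.
  apply/eqP; rewrite eqn_leq; apply/andP; split.
    by apply/leq_sizeP => j pj; rewrite fE ?(leq_trans _ pj) // bin_small // mulr0n mul0r.
  by rewrite ltnNge; apply/negP => /leq_sizeP/(_ p (leqnn _))/eqP; rewrite fp oner_eq0.
have mf : f \is monic by rewrite monicE lead_coefE sf fp.
have evf y : (map_poly (in_alg L) f).[y] = ((z%:A * y + 1) ^+ p - h%:A) / (z ^+ p)%:A.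
  rewrite map_polyZ hornerZ rmorphB rmorphXn rmorphD rmorph1 /= map_polyZ map_polyX map_polyC.
  by rewrite !hornerE mulrC -!in_algE fmorphV.
have fx : (map_poly (in_alg L) f).[x] = 0.
  have zx : z%:A * x = alpha - 1.
    by rewrite mulrC divfK // scaler_eq0 (negPf z0) oner_eq0.
  by rewrite evf zx subrK ah subrr mul0r.
have fpos i : (0 < i)%N -> f`_i \in A.
  move=> i0; have [pi|ip|<-] := ltngtP p i; last by rewrite fp rpred1.
    by rewrite nth_default ?rpred0 // sf.
  (* The binomial gives a factor [p], which cancels [z ^+ p.-1] up to a unit; [z ^+ i] cancels the
     remaining [z]. *)
  rewrite fE //; have /divnK <- : (p %| 'C(p, i))%N by rewrite prime_dvd_bin // i0.
  rewrite -mulr_natr natrM.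
  have -> : z ^+ i * (('C(p, i) %/ p)%:R * p%:R) / z ^+ p =
     ('C(p, i) %/ p)%:R * z ^+ i.-1 * (p%:R / z ^+ p.-1).
    have zS j : (0 < j)%N -> z ^+ j = z * z ^+ j.-1 by move=> j0; rewrite -exprS prednK.
    rewrite (zS i) // (zS p) //.
    by move: (_ %/ p)%:R (z ^+ p.-1) (expf_neq0 p.-1 z0) => n zp zp0; field; rewrite z0 zp0.
  apply: rpredM; last exact: vunitW Uz.
  by rewrite rpredM ?rpred_nat // rpredX // (vmaxW _ _ mz).
(* Solving [f(x) = 0] for the constant coefficient shows that it is integral. *)
have f0 : f`_0 \in A.
  rewrite -(icl_alg K L A A_total).
  move: fx; rewrite horner_coef size_map_poly sf big_ord_recl coef_map mulr1.
  move/(canRL (addrK _)); rewrite sub0r => f0E.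
  rewrite -[_%:A]/(in_alg L f`_(@ord0 p)) f0E.
  rewrite rpredN rpred_sum // => i _; rewrite rpredM ?rpredX // coef_map.
  by apply: icl_algid; apply: fpos.
have fA i : f`_i \in A by case: i => [|i] //; apply: fpos.
have [a [Aa ma]] := residual x Bx.
have mfa : f.[a] \in mA.
  rewrite -(vmax_alg K L A A_total) -in_algE -horner_map.
  rewrite -vmaxN -sub0r -fx horner_sub_vmax //; first exact: icl_total.
    by move=> i; rewrite coef_map icl_algid.
  exact: icl_algid.
have Uf' : f^`().[a] \in UA.
  have -> : f^`().[a] = p%:R / z ^+ p.-1 * (z * a + 1) ^+ p.-1.
    rewrite derivZ derivB derivC subr0 deriv_exp derivD derivZ derivX derivC addr0.
    rewrite !hornerE hornerMn !hornerE -mulr_natr -{1}(prednK p0) exprS.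
    by move: (_ ^+ p.-1) (z ^+ p.-1) (expf_neq0 p.-1 z0) => n zp zp0; field; rewrite z0 zp0.
  rewrite vunitM // vunitX // addrC vunitDr ?vunit1 //.
  by rewrite vmaxMr.
have [b [_ /rootP fb _]] := A_hensel f a mf fA Aa (vmaxP _ _ _ mfa) (vunitP _ _ _ Uf').
(* A root [b] of [f] makes [h] the [p]-th power of [z * b + 1]. *)
have /eqP := kummer_gen_not_power K L p zeta p_pr zeta_prim dimL h (z * b + 1) kh.
apply; apply/eqP; move/eqP: fb; rewrite hornerZ mulf_eq0 invr_eq0 expf_eq0.
rewrite (negPf z0) andbF /=.
by rewrite !hornerE subr_eq0 eq_sym.
Qed.

(** Take [c] with the value of [alpha - 1] and [g = z / c]. If [g] were not in [A], then [c / z]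
    would be, making [(alpha - 1) / z] integral against [in_S_distance]. *)
Lemma in_S_gamma alpha : in_S alpha ->
  exists g : K, g \in A /\ g%:A * (alpha - 1) / z%:A \in UB.
Proof.
move=> Sa; have nB := in_S_distance alpha Sa.
have z0 := zeta_sub1_neq0 K p p_pr zeta zeta_prim.
have zA0 : z%:A != 0 :> L by rewrite scaler_eq0 (negPf z0) oner_eq0.
have [|c [c0 Uc]] := unramified (alpha - 1).
  by apply: contraNneq nB => ->; rewrite mul0r rpred0.
have cA0 : c%:A != 0 :> L by rewrite scaler_eq0 (negPf c0) oner_eq0.
exists (z / c); split.
  apply: contraR nB => /(vmaxV_notin _ _ A_total)/vmaxW; rewrite invf_div => Acz.
  rewrite -(divfK cA0 (alpha - 1)) -(mulrA (_ / _)) rpredM ?(vunitW _ _ Uc) //.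
  by rewrite -!in_algE -fmorphV -rmorphM icl_algid.
rewrite -in_algE rmorphM fmorphV /=.
by have -> : z%:A / c%:A * (alpha - 1) / z%:A = (alpha - 1) / c%:A by field; rewrite cA0 zA0.
Qed.

Lemma adjoin_ring_sub (x y : L) : adjoin_ring A x y ->
  forall w, adjoin_ring A y w -> adjoin_ring A x w.
Proof.
move=> [q [Aq ->]] w [r [Ar ->]]; exists (r \Po q); split.
  by apply/polyOverP/polyOver_comp; apply/polyOverP.
by rewrite map_comp_poly horner_comp.
Qed.

(** Here [k] stands for [gamma / (zeta - 1)], so [k1 / k2 \in A] says that [a1] is at least as far
    from 1 as needed: [v (a1 - 1) <= v (a2 - 1)]. *)
Lemma in_S_adjoin a1 a2 k1 k2 : in_S a1 -> in_S a2 -> k2 != 0 ->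
  k1%:A * (a1 - 1) \in UB -> k2%:A * (a2 - 1) \in UB -> k1 / k2 \in A ->
  adjoin_ring A (k2%:A * (a2 - 1)) (k1%:A * (a1 - 1)).
Proof.
move=> /in_SP[g1 m1 [h1 ah1]] /in_SP[g2 m2 [h2 ah2]] k20 U1 U2 k12.
have [d [i [_ d0 a1E]]] :=
  kummer_generators K L p zeta p_pr zeta_prim dimL a1 a2 h1 h2 g1 g2 ah1 ah2.
have U1' : a1 \in UB.
  by rewrite -(subrK 1 a1) addrC; apply: vunitDr; rewrite ?vunit1 //; apply: icl_total.
have U2' : a2 \in UB.
  by rewrite -(subrK 1 a2) addrC; apply: vunitDr; rewrite ?vunit1 //; apply: icl_total.
have Ad : d \in A.
  rewrite -(icl_alg K L A A_total); have /vunit_neq0 a2i := vunitX _ _ _ i U2'.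
  by rewrite -(mulfK a2i d%:A) -a1E rpredM ?(vunitW _ _ U1') // (vunitW L) // vunitV vunitX.
have k2A0 : k2%:A != 0 :> L by rewrite scaler_eq0 (negPf k20) oner_eq0.
set x2 := k2%:A * (a2 - 1) in U2 *; set x1 := k1%:A * _ in U1 *.
have Ak2 : k2^-1 \in A.
  rewrite -(icl_alg K L A A_total) -in_algE fmorphV /=.
  have -> : (k2%:A)^-1 = (a2 - 1) / x2.
    have /vunit_neq0 := U2; rewrite mulf_eq0 => /norP[_ a20].
    by rewrite /x2; field; rewrite k2A0 a20.
  by rewrite rpredM ?(vmaxW _ _ m2) // (vunitW L) // vunitV.
(* Obtained by writing [a2 = k2^-1 x2 + 1] in [k1 d (a2 ^+ i - 1)] and factoring out [a2 - 1]. *)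
pose R : {poly K} := (k1 / k2 * d) *: ('X * \sum_(j < i) (k2^-1 *: 'X + 1) ^+ j).
have RA : R \is a polyOver A.
  have AX : 'X \is a polyOver A by apply: polyOverX.
  apply: polyOverZ; first exact: rpredM.
  apply: rpredM => //; apply: rpred_sum => j _.
  by rewrite rpredX // rpredD ?rpred1 // polyOverZ.
have Rx2 : (map_poly (in_alg L) R).[x2] = k1%:A * d%:A * (a2 ^+ i - 1).
  rewrite map_polyZ hornerZ [map_poly _ ('X * _)]rmorphM /= map_polyX.
  rewrite hornerM hornerX rmorph_sum horner_sum.
  rewrite subrX1 /x2 -!in_algE !rmorphM fmorphV /=.
  under eq_bigr => j _.
    rewrite rmorphXn rmorphD rmorph1 /= map_polyZ map_polyX !hornerE fmorphV /=.
    rewrite mulVf // mul1r subrK.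
    over.
  by move: (\sum_(j < i) _) => s; field.
pose e := k1 * (d - 1).
have x1E : x1 = (map_poly (in_alg L) R).[x2] + e%:A.
  rewrite Rx2 /x1 a1E /e -!in_algE rmorphM rmorphB rmorph1 /=; ring.
(* [e] is the difference of the integral elements [x1] and [R(x2)], and lies in K. *)
have Ae : e \in A.
  rewrite -(icl_alg K L A A_total) -(addKr (map_poly (in_alg L) R).[x2] e%:A) -x1E.
  rewrite rpredD ?(vunitW _ _ U1) // rpredN icl_horner ?(vunitW _ _ U2) //.
  exact/polyOverP.
exists (R + e%:P); split; first by apply/polyOverP; rewrite rpredD // polyOverC.
by rewrite rmorphD /= map_polyC hornerD hornerC.
Qed.

Lemma in_S_cover h (beta : L) : kummer_gen L p h -> beta \in B ->
  exists2 alpha, in_S alpha & forall k : K,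
    k%:A * (alpha - 1) \in UB -> adjoin_ring A (k%:A * (alpha - 1)) beta.
Proof.
move=> kh Bb; have [theta Sth] := in_S_exists h kh.
have [gth mth [g thg]] := (in_SP theta).1 Sth.
have [f sf fE] := generates_span K L p dimL theta beta gth.
have [f0|f0] := eqVneq f 0.
  exists theta => // k _; exists 0; split; first by move=> i; rewrite coef0 rpred0.
  by rewrite fE f0 rmorph0 !horner0.
have Uj j : (0 < j < size f)%N -> j%:R \in UA.
  move=> /andP[j0 jf]; apply: (vunit_nat K A A_total p) => //.
  rewrite coprime_sym prime_coprime // gtnNdvd //; exact: leq_trans jf sf.
have D0 c d : radius theta c d -> d != 0 by case.
(* Requiring [d / d1 \in A] keeps [c] at least as close to theta as 1 is, which makes [c] a
   1-unit. *)
have [d1 Dd1] := radius_center theta gth 1.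
have [c [d [Dcd H]]] :
    eventually K A (radius theta) (fun c d => dominant K A f c d /\ d / d1 \in A).
  apply: eventually_and => //; last by exists 1, d1; split.
  apply: eventually_dominant => //.
  - exact: radius_center.
  - exact: radius_dist.
  - exact: radius_refine.
have [|domf dd1] := H c d Dcd; first by rewrite divff ?rpred1 ?(D0 _ _ Dcd).
have FA := dominant_integral theta f c d Dcd domf; rewrite -fE in FA.
have {}FA := FA Bb; set F := f \Po _ in FA.
have [d0 Ud] := Dcd; have [d10 Ud1] := Dd1.
have nz (y : K) : y != 0 -> y%:A != 0 :> L.
  by move=> y0; rewrite scaler_eq0 (negPf y0) oner_eq0.
have mtc : theta - c%:A \in mB.
  rewrite -(divfK (nz d d0) (theta - c%:A)) vmaxMl ?(vunitW _ _ Ud) //.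
  rewrite -(divfK d10 d) -in_algE rmorphM vmaxMl ?icl_algid //=.
  have /vunit_neq0 u0 := Ud1; rewrite scale1r in Ud1 u0.
  have -> : d1%:A = ((theta - 1) / d1%:A)^-1 * (theta - 1).
    move: u0; rewrite mulf_eq0 => /norP[t0 _].
    by field; rewrite nz // t0.
  by rewrite vmaxMl // (vunitW L) // vunitV.
have mc : c - 1 \in mA.
  rewrite -(vmax_alg K L A A_total) scalerBl scale1r.
  have -> : c%:A - 1 = (theta - 1) - (theta - c%:A) by ring.
  by rewrite vmaxB //; apply: icl_total.
have Uc : c \in UA.
  by rewrite -(subrK 1 c) addrC; apply: vunitDr; rewrite ?vunit1.
have c0 := vunit_neq0 _ _ Uc; have cA0 := nz c c0.
have aE : c^-1%:A * theta - 1 = (theta - c%:A) / c%:A.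
  by rewrite -in_algE fmorphV /=; field.
exists (c^-1%:A * theta).
  apply/in_SP; split; first by apply: generatesZ; rewrite // invr_eq0.
    by rewrite aE vmaxMr // (vunitW L) // vunitV vunit_alg.
  by exists (c^-1 ^+ p * g); rewrite exprMn thg -!in_algE rmorphM rmorphXn.
move=> k; rewrite aE; set x := k%:A * _; set u := (theta - _) / d%:A in Ud.
have xE : x = (k * d / c)%:A * u.
  rewrite /x /u -!in_algE !(rmorphM, fmorphV) /=.
  by field; rewrite nz // cA0.
(* Both [x] and [u] are units, so they differ by a unit of [A] and rescaling the variable of [F]
   preserves coefficients in [A]. *)
move=> Ux; have Uk : k * d / c \in UA.
  rewrite -(vunit_alg K L A A_total); have u0 := vunit_neq0 _ _ Ud.
  by rewrite -(mulfK u0 (_%:A)) -xE vunitM // vunitV.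
have k0 := vunit_neq0 _ _ Uk.
exists (F \Po ((k * d / c)^-1 *: 'X)); split.
  apply/polyOverP/polyOver_comp; first exact/polyOverP.
  by rewrite polyOverZ ?polyOverX // (vunitW K) // vunitV.
rewrite map_comp_poly horner_comp map_polyZ map_polyX hornerZ hornerX fmorphV.
by rewrite xE mulKf ?nz // /F /u horner_comp_affine.
Qed.

End DefectKummer.

(** * Choice of gamma, comparison of the rings, and covering of B *)

Theorem theorem5p1 (K : fieldType) (L : fieldExtType K) (A : {pred K})
  (p : nat) (zeta : K) :
  (* K has characteristic 0 *)
  [pchar K] =i pred0 ->
  (* A is a henselian valuation ring of K *)
  valuation_ring A -> henselian A ->
  (* residue field of characteristic p > 0 *)
  prime p -> maxideal_in (memA A) (p%:R : K) ->
  (* zeta is a primitive p-th root of unity in K *)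
  p.-primitive_root zeta ->
  (* L|K is a Kummer extension of degree p *)
  \dim {:L} = p -> (exists h : K, kummer_gen L p h) ->
  (* defect p, i.e. e = 1 and f = 1, with B the valuation ring of the
     (unique) extension w of v to L, i.e. the integral closure of A in L *)
  (forall y : L, y != 0 -> exists c : K,
        c != 0 /\ unit_in (integral_closure A) (y / c%:A)) ->
  (forall b : L, integral_closure A b -> exists a : K,
        a \in A /\ maxideal_in (integral_closure A) (b - a%:A)) ->
  let inAp (h : K) := [/\ kummer_gen L p h, unit_in (memA A) h &
                          maxideal_in (memA A) (h - 1)] in
  let inS (alpha : L) := exists h : K, inAp h /\ alpha ^+ p = h%:A in
  exists gamma : L -> K,
    let alpha' (alpha : L) :=
      (gamma alpha)%:A * (alpha - 1) / (zeta - 1)%:A in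
    [/\ (forall alpha, inS alpha ->
           gamma alpha \in A /\ unit_in (integral_closure A) (alpha' alpha)),
        (forall a1 a2, inS a1 -> inS a2 ->
           (forall y, adjoin_ring A (alpha' a1) y -> adjoin_ring A (alpha' a2) y) \/
           (forall y, adjoin_ring A (alpha' a2) y -> adjoin_ring A (alpha' a1) y)) &
        (forall beta : L, integral_closure A beta ->
           exists2 alpha, inS alpha & adjoin_ring A (alpha' alpha) beta)].
Proof.
move=> char0 [A1 AB AM A_total] hensA p_pr pm zp dimL [h0 kh0] ram res inAp inS.
pose S : subringClosed K :=
  HB.pack A (GRing.isSubringClosed.Build K A (And3 A1 AB AM)).
have p_max : p%:R \in vmax K S by apply/vmaxP.
have p0 : p%:R != 0 :> K.
  by apply/negP => p0; have := char0 p; rewrite !inE p_pr p0.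
have BP (x : L) : reflect (integral_closure A x) (x \in icl K L S) := iclP K L S x.
have unitP (x : L) : unit_in (integral_closure A) x <-> x \in vunit L (icl K L S).
  by split=> [[x0 /BP Bx /BP Bx']|/and3P[x0 /BP Bx /BP Bx']]; first apply/and3P.
have unramified (y : L) : y != 0 ->
    exists c : K, c != 0 /\ y / c%:A \in vunit L (icl K L S).
  by move=> /ram[c [c0 /unitP Uc]]; exists c.
have residual (b : L) : b \in icl K L S ->
    exists a : K, a \in S /\ b - a%:A \in vmax L (icl K L S).
  move=> /BP/res[a [Aa [/BP Bba nU]]]; exists a; split=> //.
  by apply/andP; split=> //; apply/negP => /unitP.
(* The implication is inside the existential so that [choice] yields a total function; outside S the
   value is 0. *)
have gammaP alpha : exists g : K, inS alpha ->
    g \in A /\ unit_in (integral_closure A) (g%:A * (alpha - 1) / (zeta - 1)%:A).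
  have [Sa|nSa] := EM (inS alpha); last by exists 0.
  have [g [Ag /unitP Ug]] := in_S_gamma K L S p zeta A_total hensA p_pr p_max zp
    p0 dimL unramified residual alpha Sa.
  by exists g.
have [gamma gammaE] := choice gammaP; exists gamma => alpha'.
have alpha'E a : alpha' a = (gamma a / (zeta - 1))%:A * (a - 1).
  by rewrite /alpha' mulrAC -!in_algE -fmorphV -rmorphM.
have Ua a : inS a -> (gamma a / (zeta - 1))%:A * (a - 1) \in vunit L (icl K L S).
  by move=> /gammaE[_ /unitP]; rewrite -alpha'E.
split; first exact: gammaE.
- move=> a1 a2 Sa1 Sa2; have [U1 U2] := (Ua a1 Sa1, Ua a2 Sa2).
  have knz k (x : L) : k%:A * x \in vunit L (icl K L S) -> k != 0.
    by move=> /vunit_neq0; rewrite mulf_eq0 scaler_eq0 => /norP[/norP[]].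
  have [k1 k2] := (knz _ _ U1, knz _ _ U2).
  have sub b1 b2 (Sb1 : inS b1) (Sb2 : inS b2) :=
    in_S_adjoin K L S p zeta A_total p_pr p_max zp dimL unramified b1 b2 _ _ Sb1 Sb2.
  rewrite !alpha'E.
  (* Totality of [A] decides which ring contains the other. *)
  have [||Ak] := A_total (gamma a1 / (zeta - 1) / (gamma a2 / (zeta - 1))).
  + by rewrite mulf_neq0 // invr_eq0.
  + by left; apply: (adjoin_ring_sub K L S); apply: sub.
  + by right; apply: (adjoin_ring_sub K L S); apply: sub; rewrite // -[_ / _]invf_div.
- move=> beta /BP Bb.
  have [alpha Sa cover] := in_S_cover K L S p zeta A_total hensA p_pr p_max zp
    dimL unramified residual h0 beta kh0 Bb.
  by exists alpha => //; rewrite alpha'E; apply: cover; apply: Ua.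
Qed.
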